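(* Let $\mathbb K$ be a complete separable non-Archimedean valued field with nontrivial valuation, and let $B_{\mathbf a}$ be a bilateral weighted backward shift operator on $c_0(\mathbb Z)$ with weight sequence $\mathbf a=(a_n)_{n\in\mathbb Z}$. Then the following statements hold: (i) $B_{\mathbf a}$ is hypercyclic if and only if, for any $q\in\mathbb N$, $$\liminf_{n\to+\infty}\max\left\{\prod_{i=1}^{n+q}|a_i^{-1}|,\ \prod_{j=1}^{n-q}|a_{-j+1}|\right\}=0.$$ (ii) $B_{\mathbf a}$ is supercyclic if and only if, for any $q\in\mathbb N$, $$\liminf_{n\to+\infty}\ \prod_{i=1}^{n+q}|a_i^{-1}|\times\prod_{j=1}^{n-q}|a_{-j+1}|=0.$$
   Context: A non-Archimedean valued field is a commutative field $\mathbb K$ with a map $|\cdot|:\mathbb K\to[0,+\infty)$ such that $|\lambda|=0$ iff $\lambda=0$, $|\lambda\mu|=|\lambda||\mu|$, and $|\lambda+\mu|\le\max\{|\lambda|,|\mu|\}$; the valuation is always assumed nontrivial. $c_0(\mathbb Z)=\{(x_n)_{n\in\mathbb Z}: x_n\in\mathbb K,\ |x_{\pm n}|\to 0 \text{ as } n\to+\infty\}$ with norm $\|\mathbf x\|=\sup_n|x_n|$, assumed to be a separable Banach space (equivalently, $\mathbb K$ is complete and separable). $\mathbf e_n$ is the vector whose $n$-th coordinate is $1$ and whose other coordinates are $0$. For a bounded sequence $\mathbf a=(a_n)_{n\in\mathbb Z}$ of non-zero elements of $\mathbb K$, $B_{\mathbf a}$ is the continuous linear operator on $c_0(\mathbb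 Z)$ with $B_{\mathbf a}(\mathbf e_n)=a_n\mathbf e_{n-1}$ for $n\in\mathbb Z$; it is called a bilateral weighted backward shift if $a_i\ne 1$ for some $i\in\mathbb Z$ (and unweighted otherwise). A continuous linear operator $T$ on $X$ is hypercyclic if some orbit $\{T^n(\mathbf x): n\ge 0\}$, $\mathbf x\in X$, is dense in $X$, and supercyclic if some projective orbit $\{\lambda T^n(\mathbf x): n\ge 0,\ \lambda\in\mathbb K\}$, $\mathbf x\in X$, is dense in $X$. $\mathbb N=\{1,2,3,\dots\}$. *)

(* Defs.v *)
From HB Require Import structures.
From mathcomp Require Import all_boot all_order all_algebra.
From mathcomp Require Import all_classical all_reals all_analysis.

Set Implicit Arguments.
Unset Strict Implicit.
Unset Printing Implicit Defensive.

Import Order.TTheory GRing.Theory Num.Theory.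
Import numFieldNormedType.Exports.

Local Open Scope classical_set_scope.
Local Open Scope ring_scope.

(* [valr x] is the valuation |x|. MathComp's [normedZmodType] cannot carry it:
   its axiom [`|x *+ n| = `|x| *+ n] contradicts the strong triangle
   inequality. *)
HB.mixin Record Field_isNonArchValued (R : realType) K & GRing.Field K := {
  valr : K -> R ;
  valr_ge0 : forall x, 0 <= valr x ;
  valr_eq0 : forall x, valr x = 0 <-> x = 0 ;
  valrM : forall x y, valr (x * y) = valr x * valr y ;
  valrD_max : forall x y, valr (x + y) <= Num.max (valr x) (valr y)
}.

#[short(type="nonArchValuedFieldType")]
HB.structure Definition NonArchValuedField (R : realType) :=
  {K of GRing.Field K & Field_isNonArchValued R K}.

Section ValuationTheory.
Context {R : realType} {K : nonArchValuedFieldType R}.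
Implicit Types x y : K.

Lemma valr0 : valr (0 : K) = 0.
Proof. exact/valr_eq0. Qed.

Lemma valr1 : valr (1 : K) = 1.
Proof.
have v1 : valr (1 : K) != 0.
  by apply/eqP => /valr_eq0/eqP; rewrite oner_eq0.
by apply: (mulfI v1); rewrite -valrM !mulr1.
Qed.

Lemma valrN x : valr (- x) = valr x.
Proof.
have vN1 : valr (-1 : K) = 1.
  have : valr (-1 : K) ^+ 2 = 1 by rewrite expr2 -valrM mulrNN mulr1 valr1.
  move/eqP; rewrite sqrf_eq1 => /orP[/eqP//|/eqP v].
  by have := valr_ge0 (-1 : K); rewrite v lerNr oppr0 ler10.
by rewrite -mulN1r valrM vN1 mul1r.
Qed.

Lemma valrB x y : valr (x - y) = valr (y - x).
Proof. by rewrite -valrN opprB. Qed.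

Lemma valrB_triangle y x z : valr (x - z) <= valr (x - y) + valr (y - z).
Proof.
rewrite -(subrKA y x (- z)) (le_trans (valrD_max _ _)) // ge_max.
by rewrite lerDl valr_ge0 lerDr valr_ge0.
Qed.

End ValuationTheory.

(* Alias of [K] carrying the metric |x - y|. *)
Definition valued_metric (R : realType) (K : nonArchValuedFieldType R) : Type :=
  K.

Section ValuedMetric.
Context {R : realType} (K : nonArchValuedFieldType R).

Let dist (x y : valued_metric K) : R := valr ((x : K) - y).

Let distxx x : dist x x = 0.
Proof. by rewrite /dist subrr valr0. Qed.

Let dist_eq0 x y : dist x y = 0 -> x = y.
Proof. by move/valr_eq0/eqP; rewrite subr_eq0 => /eqP. Qed.

Let dist_sym x y : dist x y = dist y x.
Proof. exact: valrB. Qed.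

Let dist_triangle y x z : dist x z <= dist x y + dist y z.
Proof. exact: valrB_triangle. Qed.

HB.instance Definition _ := Choice.copy (valued_metric K) K.
HB.instance Definition _ := isMetric.Build R (valued_metric K)
  distxx dist_eq0 dist_sym dist_triangle.

End ValuedMetric.

Definition nontrivially_valued (R : realType) (K : nonArchValuedFieldType R) :=
  exists x : K, x != 0 /\ valr x != 1.

Definition complete_space (T : uniformType) :=
  forall F : set_system T, ProperFilter F -> cauchy F -> exists l : T, F --> l.

Definition separable_space (T : topologicalType) :=
  exists D : set T, countable D /\ dense D.

Section C0.
Context {R : realType} {K : nonArchValuedFieldType R}.
Implicit Types x y : int -> K^o.

Definition null_at_infinities x :=
  valr (x n%:Z) @[n --> \oo] --> (0 : R) /\
  valr (x (- n%:Z)) @[n --> \oo] --> (0 : R).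

Definition c0_pred : {pred int -> K^o} := fun x => `[< null_at_infinities x >].

Lemma c0_pred_submod : submod_closed c0_pred.
Proof.
have cvg_comb (f g h : nat -> R) : (forall n, 0 <= h n) ->
    (forall n, h n <= f n + g n) ->
    f @ \oo --> (0 : R) -> g @ \oo --> (0 : R) -> h @ \oo --> (0 : R).
  move=> h0 hle f0 g0.
  apply: (@squeeze_cvgr _ _ _ _ (cst 0) (f \+ g)).
  - by apply: nearW => n; rewrite /= h0 hle.
  - exact: cvg_cst.
  - by rewrite -[X in _ --> X](addr0 0); exact: cvgD.
have cvgZ0 (c : R) (f : nat -> R) : f @ \oo --> (0 : R) ->
    (fun n => c * f n) @ \oo --> (0 : R).
  by move=> f0; rewrite -[X in _ --> X](mulr0 c); apply: cvgM => //; exact: cvg_cst.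
have le_comb (c u v : K) : valr (c * u + v) <= valr c * valr u + valr v.
  apply: (le_trans (valrD_max _ _)); rewrite valrM ge_max.
  by rewrite lerDl valr_ge0 /= lerDr mulr_ge0 ?valr_ge0.
split.
  by apply/asboolP; split; apply: cvg_near_cst; apply: nearW => n; exact: valr0.
move=> c x y /asboolP[xp xn] /asboolP[yp yn]; apply/asboolP; split.
- apply: cvg_comb (cvgZ0 (valr c) _ xp) yp => n; first exact: valr_ge0.
  exact: le_comb.
- apply: cvg_comb (cvgZ0 (valr c) _ xn) yn => n; first exact: valr_ge0.
  exact: le_comb.
Qed.

HB.instance Definition _ :=
  GRing.isSubmodClosed.Build K (int -> K^o) c0_pred c0_pred_submod.

End C0.

Record c0 (R : realType) (K : nonArchValuedFieldType R) := C0 {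
  c0_fun :> int -> K^o ;
  c0_funP : c0_fun \in c0_pred
}.

Section C0Structures.
Context {R : realType} {K : nonArchValuedFieldType R}.

HB.instance Definition _ := [isSub for @c0_fun R K].
HB.instance Definition _ := [Choice of c0 K by <:].
HB.instance Definition _ := [SubChoice_isSubLmodule of c0 K by <:].

Definition c0_norm (x : c0 K) : R := sup (range (fun n => valr (x n))).

Lemma c0_has_sup (x : c0 K) : has_sup (range (fun n => valr (x n))).
Proof.
split; first by exists (valr (x 0)); exists 0.
have /asboolP[xp xn] := c0_funP x.
have [M HM] := bounded_fun_has_ubound (cvg_seq_bounded (cvgP _ xp)).
have [N HN] := bounded_fun_has_ubound (cvg_seq_bounded (cvgP _ xn)).
exists (Num.max M N) => _ [[n|n] _ <-]; rewrite le_max.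
- by rewrite HM //; exists n.
- by rewrite NegzE HN ?orbT //; exists n.+1.
Qed.

Lemma valr_le_c0_norm (x : c0 K) n : valr (x n) <= c0_norm x.
Proof. by apply: sup_upper_bound; [exact: c0_has_sup | exists n]. Qed.

Lemma c0_norm_le (x : c0 K) (M : R) :
  (forall n, valr (x n) <= M) -> c0_norm x <= M.
Proof.
move=> xM; apply: ge_sup; first by exists (valr (x 0)); exists 0.
by move=> _ [n _ <-].
Qed.

Lemma c0_ext (x y : c0 K) : (forall n, x n = y n) -> x = y.
Proof. by move=> xy; apply: val_inj; apply/funext. Qed.

Lemma c0_subE (x y : c0 K) n : (x - y) n = x n - y n.
Proof. by []. Qed.

Let dist (x y : c0 K) : R := c0_norm (x - y).

Let distxx x : dist x x = 0.
Proof.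
apply/eqP; rewrite eq_le; apply/andP; split.
  by apply: c0_norm_le => n; rewrite c0_subE subrr valr0.
by apply: le_trans (valr_le_c0_norm _ 0); exact: valr_ge0.
Qed.

Let dist_eq0 x y : dist x y = 0 -> x = y.
Proof.
move=> xy0; apply: c0_ext => n; apply/eqP; rewrite -subr_eq0 -c0_subE.
apply/eqP/valr_eq0/eqP; rewrite eq_le valr_ge0 andbT -xy0.
exact: valr_le_c0_norm.
Qed.

Let dist_sym x y : dist x y = dist y x.
Proof.
by apply/eqP; rewrite eq_le; apply/andP; split; apply: c0_norm_le => n;
  rewrite c0_subE valrB -c0_subE valr_le_c0_norm.
Qed.

Let dist_triangle y x z : dist x z <= dist x y + dist y z.
Proof.
apply: c0_norm_le => n; rewrite c0_subE (le_trans (valrB_triangle (y n) _ _)) //.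
by rewrite -!c0_subE lerD // valr_le_c0_norm.
Qed.

HB.instance Definition _ := isMetric.Build R (c0 K)
  distxx dist_eq0 dist_sym dist_triangle.

Definition delta_seq (n : int) : int -> K^o := fun m => (m == n)%:R.

Lemma delta_seq_c0 n : delta_seq n \in c0_pred.
Proof.
apply/asboolP; split; apply/cvgrPdist_lt => e e0; near=> k;
  rewrite sub0r normrN ger0_norm ?valr_ge0 // /delta_seq;
  rewrite (_ : (_ == n) = false) ?valr0 //; apply/negbTE/eqP.
- move=> kn; have : (`|n| < k)%N by near: k; exact: nbhs_infty_gt.
  by rewrite -kn absz_nat ltnn.
- move=> kn; have : (`|n| < k)%N by near: k; exact: nbhs_infty_gt.
  by rewrite -kn abszN absz_nat ltnn.
Unshelve. all: by end_near. Qed.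

Definition basis_vec (n : int) : c0 K := C0 (delta_seq_c0 n).

End C0Structures.

Section Operators.
Context {R : realType} {K : nonArchValuedFieldType R}.
Implicit Types (T : c0 K -> c0 K).

Definition hypercyclic T :=
  exists x : c0 K, dense [set iter n T x | n in [set: nat]].

Definition supercyclic T :=
  exists x : c0 K, dense [set y | exists (c : K) (n : nat), y = c *: iter n T x].

Definition bounded_weights (a : int -> K) :=
  exists M : R, forall n, valr (a n) <= M.

(* These two conditions determine [B], as the span of the [basis_vec n] is dense
   in [c0 K]; [backward_shift_exists] below shows that such a [B] exists. *)
Definition is_backward_shift (a : int -> K) (B : {linear c0 K -> c0 K}) :=
  continuous B /\ forall n, B (basis_vec n) = a n *: basis_vec (n - 1).

Let shift_seq (a : int -> K) (x : int -> K^o) : int -> K^o :=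
  fun n => a (n + 1) * x (n + 1).

Let shift_seq_c0 a (x : c0 K) : bounded_weights a -> shift_seq a x \in c0_pred.
Proof.
move=> [M aM]; have /asboolP[xp xn] := c0_funP x.
have M0 : 0 <= M by exact: le_trans (valr_ge0 _) (aM 0).
have le_shift n : 0 <= valr (shift_seq a x n) <= M * valr (x (n + 1)).
  by rewrite valr_ge0 valrM ler_wpM2r ?valr_ge0.
have cvgM0 (f : nat -> R) : f @ \oo --> (0 : R) ->
    (fun n => M * f n) @ \oo --> (0 : R).
  by move=> f0; rewrite -[X in _ --> X](mulr0 M); apply: cvgM => //; exact: cvg_cst.
apply/asboolP; split.
- have xp1 : valr (x n.+1%:Z) @[n --> \oo] --> (0 : R)
    by rewrite (cvg_shiftS (fun n : nat => valr (x n%:Z))).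
  apply: squeeze_cvgr (cvg_cst 0) (cvgM0 _ xp1).
  by apply: nearW => n; have := le_shift n%:Z; rewrite (addrC n%:Z) -intS.
- suff : valr (shift_seq a x (- n.+1%:Z)) @[n --> \oo] --> (0 : R).
    by rewrite (cvg_shiftS (fun n : nat => valr (shift_seq a x (- n%:Z)))).
  apply: squeeze_cvgr (cvg_cst 0) (cvgM0 _ xn).
  apply: nearW => n; have := le_shift (- n.+1%:Z).
  by rewrite intS opprD addrAC addNr add0r.
Qed.

Lemma backward_shift_exists a : bounded_weights a ->
  exists B : {linear c0 K -> c0 K}, is_backward_shift a B.
Proof.
move=> aB; have [M aM] := aB.
have M0 : 0 <= M by exact: le_trans (valr_ge0 _) (aM 0).
pose f (x : c0 K) := C0 (shift_seq_c0 x aB).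
have f_linear : linear f.
  move=> c x y; apply: c0_ext => n.
  by rewrite /= /shift_seq /= mulrDr mulrCA.
pose fM := GRing.isLinear.Build K (c0 K) (c0 K) *:%R f f_linear.
pose B : {linear c0 K -> c0 K} := HB.pack f fM.
exists B; split.
  move=> x; apply/(@cvg_ballP _ _ _ _ (nbhs_filter x)) => e e0.
  have d0 : 0 < e / (M + 1) by rewrite divr_gt0 // ltr_wpDl.
  apply: filterS (nbhsx_ballx x (e / (M + 1)) d0) => y.
  rewrite !ballEmdist /= => xy.
  have BM : c0_norm (B x - B y) <= M * c0_norm (x - y).
    apply: c0_norm_le => n; rewrite -linearB valrM.
    by rewrite ler_pM ?valr_ge0 // valr_le_c0_norm.
  apply: le_lt_trans BM _.
  apply: (@le_lt_trans _ _ ((M + 1) * c0_norm (x - y))).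
    rewrite ler_wpM2r ?lerDl //.
    exact: le_trans (valr_ge0 _) (valr_le_c0_norm _ 0).
  by rewrite mulrC -ltr_pdivlMr // ltr_wpDl.
move=> n; apply: c0_ext => m.
change (a (m + 1) * (m + 1 == n)%:R = a n * (m == n - 1)%:R).
have -> : (m == n - 1) = (m + 1 == n) by rewrite [LHS]eq_sym subr_eq eq_sym.
by have [->//|_] := eqVneq; rewrite !mulr0.
Qed.

End Operators.

(* Main.v *)
Require Import Defs.
From HB Require Import structures.
From mathcomp Require Import all_boot all_order all_algebra.
From mathcomp Require Import all_classical all_reals all_analysis.
From mathcomp Require Import zify ring lra.

Import Order.TTheory GRing.Theory Num.Theory.
Import numFieldNormedType.Exports.

Local Open Scope classical_set_scope.
Local Open Scope ring_scope.

(** Both statements are instances of one: for a set [Lam] of scalars that is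
closed under quotients of nonzero elements, when is some [Lam]-orbit
[{c B^n x : c in Lam, n >= 0}] dense? Hypercyclicity is [Lam = {1}],
supercyclicity is [Lam = K]. Write [w k n] for the product
[a (k + 1) ... a (k + n)], so that coordinate [k] of [B^n x] is [w k n] times
coordinate [k + n] of [x]. The answer ([small_times]) is that for each [q]
there are arbitrarily large [n] and nonzero scalars [c] in [Lam] for which
both [|c|^-1 |w q n|^-1] and [|c| |w (q - n) n|] are small. For [n >= q],
multiplying [|w q n|^-1] and [|w (q - n) n|] by [|w 0 q|^-1] gives the two
products of the theorem. For [c = 1] this is smallness of their maximum; when
[c] is free, a nontrivial valuation takes values close enough to any given
size to balance the two terms, so only their product matters.

Necessity ([cyclic_small_times]): a dense orbit contains two vectors [z1] and
[z2] that are both close to [e_q], reached at different times; in the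
non-Archimedean norm their [q]-th coordinate then has absolute value exactly
1. If the times differ by [n], then [z2 = c B^n z1] up to the order of the
two. Coordinate [q] of this equation has absolute value 1 on the left and
involves a small coordinate of [z1] on the right, whence [|c w q n|] is large;
coordinate [q - n] is small on the left, whence [|c w (q - n) n|] is small.
The times are made different by aiming at [e_q] and at [e_q + b e_{q+1}], with
precision [|b|]: no two vectors so obtained are proportional.

Sufficiency ([small_times_cyclic]): [forward_block] says that, given vectors
[u] and [y] of finite support, some small vector [v], supported as far to the
right as desired, satisfies [c B^n v = y] while [c B^n u] is small. Adding
such blocks one after the other, for a dense sequence of targets [y], gives a
vector whose orbit comes near each target ([universal_vector]); each new block
is chosen so small that it does not spoil the approximations obtained before.
As the supports of the blocks are disjoint, every coordinate is constant from
some stage on, and the sum exists in [c_0] as a uniform limit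
([glue_blocks]). *)

(** * Limits of real sequences *)

Lemma limn_einf_eq0P (R : realType) (f : nat -> R) : (forall n, 0 <= f n) ->
  limn_einf (fun n => (f n)%:E) = (0 : R)%:E <->
  forall e, 0 < e -> forall N, exists n, (N <= n)%N /\ f n < e.
Proof.
move=> f0.
have einfs_ge0 N : (0%:E <= einfs (fun n => (f n)%:E) N)%E.
  by apply: le_ereal_inf_tmp => _ [k _ <-]; rewrite lee_fin.
have -> : limn_einf (fun n => (f n)%:E) =
    ereal_sup (range (einfs (fun n => (f n)%:E))).
  by rewrite limn_einf_lim; apply/cvg_lim => //; exact: cvg_einfs_sup.
split=> [f_inf e e0 N|f_small].
  have /ereal_inf_lt [_ [n Nn <-]] :
      (einfs (fun n => (f n)%:E) N < e%:E)%E.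
    apply: (@le_lt_trans _ _ 0%:E); last by rewrite lte_fin.
    by rewrite -f_inf; apply: ereal_sup_ubound; exists N.
  by rewrite lte_fin; exists n.
apply/eqP; rewrite eq_le; apply/andP; split; last first.
  by apply: le_trans (einfs_ge0 0) _; apply: ereal_sup_ubound; exists 0.
apply: ge_ereal_sup => _ [N _ <-]; apply/lee_addgt0Pr => e e0.
have [n [Nn fn]] := f_small e e0 N.
apply: (@le_trans _ _ (f n)%:E); last by rewrite -EFinD lee_fin add0r ltW.
by apply: ereal_inf_lbound; exists n.
Qed.

Lemma expr_lt_small (R : realType) (r e : R) : 0 <= r < 1 -> 0 < e ->
  exists n, r ^+ n < e.
Proof.
move=> /andP[r0 r1] e0.
have : (fun n => r ^+ n) @ \oo --> (0 : R) by apply: cvg_expr; rewrite ger0_norm.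
move/cvgrPdist_lt => /(_ e e0)[n _ /(_ n (leqnn n))]/=.
by rewrite sub0r normrN ger0_norm ?exprn_ge0//; exists n.
Qed.

(** * Valuations *)

Section Valuation.
Context {R : realType} {K : nonArchValuedFieldType R}.
Implicit Types x y z : K.

Lemma valr_gt0 x : (0 < valr x) = (x != 0).
Proof.
rewrite lt_neqAle valr_ge0 andbT eq_sym; congr negb.
by apply/eqP/eqP => /valr_eq0.
Qed.

Lemma valrV x : valr x^-1 = (valr x)^-1.
Proof.
have [->|x0] := eqVneq x 0; first by rewrite invr0 valr0 invr0.
have vx0 : valr x != 0 by rewrite gt_eqF ?valr_gt0.
by apply: (mulfI vx0); rewrite -valrM !mulfV// valr1.
Qed.

Lemma valr_prod (I : Type) (r : seq I) (F : I -> K) :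
  valr (\prod_(i <- r) F i) = \prod_(i <- r) valr (F i).
Proof.
by elim/big_rec2 : _ => [|i u v _ <-]; rewrite ?valr1 ?valrM.
Qed.

Lemma valrX x n : valr (x ^+ n) = valr x ^+ n.
Proof. by elim: n => [|n IH]; rewrite ?expr0 ?valr1// !exprS valrM IH. Qed.

Lemma valrD_le x y e : valr x <= e -> valr y <= e -> valr (x + y) <= e.
Proof.
by move=> xe ye; rewrite (le_trans (valrD_max _ _))// ge_max xe ye.
Qed.

Lemma valrD_lt x y e : valr x < e -> valr y < e -> valr (x + y) < e.
Proof.
by move=> xe ye; rewrite (le_lt_trans (valrD_max _ _))// gt_max xe ye.
Qed.

(** The isosceles principle: by the ultrametric inequality, an error smaller
than [y] leaves the valuation of [y] exactly unchanged. *)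
Lemma valr_isosceles x y : valr (x - y) < valr y -> valr x = valr y.
Proof.
move=> xy; apply/eqP; rewrite eq_le; apply/andP; split.
  by rewrite -(subrK y x) valrD_le// ltW.
rewrite leNgt; apply/negP => yx.
have := valrD_lt (y - x) x (valr y).
by rewrite subrK valrB xy yx ltxx => /(_ isT isT).
Qed.

Hypothesis K_nontrivial : nontrivially_valued K.

Lemma exists_valr_lt1 : exists p : K, 0 < valr p < 1.
Proof.
have [x [x0]] := K_nontrivial.
have vx0 : 0 < valr x by rewrite valr_gt0.
rewrite neq_lt => /orP[x1|x1]; first by exists x; rewrite vx0.
by exists x^-1; rewrite valrV invr_gt0 vx0 invf_lt1.
Qed.

(** The powers of [p] are spaced by the factor [valr p], so the largest of them
below [t] is at most that factor away from [t]. *)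
Lemma exists_valr_between (p : K) (t : R) : 0 < valr p < 1 -> 0 < t ->
  exists c : K, [/\ c != 0, valr c <= t & t * valr p < valr c].
Proof.
move=> /andP[p0 p1] t0; have p0' := p0; rewrite valr_gt0 in p0'.
have pr : 0 <= valr p < 1 by rewrite ltW.
have ti0 : 0 < t^-1 by rewrite invr_gt0.
have [N pN] := expr_lt_small _ _ _ pr ti0.
pose f n := valr p ^+ n / valr p ^+ N.
have pN0 : 0 < valr p ^+ N by rewrite exprn_gt0.
have ex : exists n, f n <= t.
  have [n /ltW pn] := expr_lt_small _ _ (t * valr p ^+ N) pr (mulr_gt0 t0 pN0).
  by exists n; rewrite /f ler_pdivrMr.
(* [p ^ (- N)] exceeds [t], so the least [n] with [p ^ (n - N)] at most [t] is
   positive and its predecessor gives a value greater than [t]. *)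
case: (ex_minnP ex) => [[|n]] fn minn.
  move: fn; rewrite /f expr0 mul1r => fn.
  by move: pN; rewrite -ltf_pV2 ?posrE// invrK ltNge fn.
exists (p ^+ n.+1 / p ^+ N); split.
- by rewrite mulf_neq0 ?invr_eq0 ?expf_neq0.
- by rewrite valrM valrV !valrX.
- rewrite valrM valrV !valrX exprSr mulrAC ltr_pM2r//.
  by rewrite ltNge; apply/negP => /minn; rewrite ltnn.
Qed.

Lemma exists_valr_small (e : R) : 0 < e -> exists2 c : K, c != 0 & valr c < e.
Proof.
move=> e0; have [p p01] := exists_valr_lt1.
have [c [c0 ce _]] := exists_valr_between p (e / 2) p01 (divr_gt0 e0 (ltr0Sn _ 1)).
by exists c; rewrite // (le_lt_trans ce)// ltr_pdivrMr// ltr_pMr// ltr1n.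
Qed.

End Valuation.

(** * The space of null sequences *)

Section C0Facts.
Context {R : realType} {K : nonArchValuedFieldType R}.
Implicit Types (x y u : c0 K) (S : set (c0 K)).

Definition supported_le (x : int -> K) (N : nat) :=
  forall m : int, (N < `|m|)%N -> x m = 0.

Lemma dense_c0P S : dense S <-> forall y e, 0 < e ->
  exists2 s, S s & forall m, valr (s m - y m) < e.
Proof.
split=> [Sd y e e0|Sd O [y Oy] Oo].
  have [] := Sd (ball y e)°.
  - by exists y; exact: nbhsx_ballx.
  - exact: open_interior.
  move=> s [/interior_subset]; rewrite ballEmdist/= => sy Ss.
  exists s => // m; rewrite valrB -c0_subE.
  exact: le_lt_trans (valr_le_c0_norm _ m) sy.
have /(@nbhs_ballP R)[e /= e0 ye] : nbhs y O by apply: open_nbhs_nbhs.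
have [s Ss sy] := Sd y (e / 2) (divr_gt0 e0 (ltr0Sn _ 1)).
exists s; split => //; apply: ye; rewrite ballEmdist/=.
apply: (@le_lt_trans _ _ (e / 2)); last by rewrite ltr_pdivrMr// ltr_pMr// ltr1n.
by apply: c0_norm_le => m; rewrite c0_subE valrB ltW.
Qed.

Lemma c0_predP (x : int -> K^o) : x \in c0_pred <->
  forall e : R, 0 < e -> exists N : nat, forall m : int, (N < `|m|)%N -> valr (x m) < e.
Proof.
split=> [/asboolP[xp xn] e e0|xs].
  move/cvgrPdist_lt : xp => /(_ e e0)[N1 _ H1].
  move/cvgrPdist_lt : xn => /(_ e e0)[N2 _ H2].
  exists (maxn N1 N2) => -[m|m] Nm.
    have := H1 m; rewrite /= sub0r normrN ger0_norm ?valr_ge0//; apply; lia.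
  have := H2 m.+1; rewrite /= sub0r normrN ger0_norm ?valr_ge0// NegzE.
  apply; lia.
apply/asboolP; split; apply/cvgrPdist_lt => e e0; have [N xN] := xs e e0;
  exists N.+1 => // n /= Nn; rewrite sub0r normrN ger0_norm ?valr_ge0//;
  apply: xN; lia.
Qed.

Lemma c0_pred_supported (x : int -> K^o) N : supported_le x N -> x \in c0_pred.
Proof.
by move=> xN; apply/c0_predP => e e0; exists N => m /xN ->; rewrite valr0.
Qed.

(** The candidate limit is given coordinatewise; only its decay at infinity has
to be checked, and it is inherited from a close enough approximant. *)
Lemma c0_pred_uniform_limit (x : int -> K^o) :
  (forall e : R, 0 < e -> exists u, forall m, valr (x m - u m) < e) ->
  x \in c0_pred.
Proof.
move=> xu; apply/c0_predP => e e0; have [u ux] := xu e e0.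
have [N uN] := (c0_predP u).1 (c0_funP u) e e0.
exists N => m /uN um; rewrite -(subrK (u m) (x m)).
exact: valrD_lt.
Qed.

Definition truncate_fun (x : int -> K^o) (N : nat) (m : int) : K^o :=
  if (`|m| <= N)%N then x m else 0.

Lemma truncate_supported (x : int -> K^o) N : supported_le (truncate_fun x N) N.
Proof. by move=> m; rewrite /truncate_fun ltnNge => /negbTE ->. Qed.

Definition truncate (x : c0 K) N : c0 K :=
  C0 (c0_pred_supported _ _ (truncate_supported x N)).

Lemma c0_sumE (I : Type) (r : seq I) (F : I -> c0 K) m :
  (\sum_(i <- r) F i) m = \sum_(i <- r) F i m.
Proof.
by elim/big_rec2 : _ => // i u v _ <-.
Qed.

Lemma supported_le_sum u N : supported_le u N ->
  u = \sum_(i < N.*2.+1) u (i%:Z - N%:Z) *: basis_vec (i%:Z - N%:Z).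
Proof.
move=> uN; apply: c0_ext => m; rewrite c0_sumE.
have E i : (u (i%:Z - N%:Z) *: basis_vec (i%:Z - N%:Z)) m =
    u (i%:Z - N%:Z) * (m == i%:Z - N%:Z)%:R :> K by [].
have [mN|mN] := leqP `|m| N; last first.
  rewrite uN// big1// => i _; rewrite E.
  have /negbTE -> : m != i%:Z - N%:Z.
    by have := ltn_ord i; lia.
  by rewrite mulr0.
have mi : (absz (m + N%:Z)%R < N.*2.+1)%N by lia.
rewrite (bigD1 (Ordinal mi))// E big1.
  have -> : (Ordinal mi)%:Z - N%:Z = m by rewrite /=; lia.
  by rewrite eqxx mulr1 [RHS]addr0.
move=> i; rewrite E -val_eqE/= => im.
have /negbTE -> : m != i%:Z - N%:Z by lia.
by rewrite mulr0.
Qed.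

End C0Facts.

Lemma separable_enum (R : realType) (K : nonArchValuedFieldType R) :
  separable_space (valued_metric K) ->
  exists d : nat -> K, forall (x : K) (e : R), 0 < e -> exists i, valr (d i - x) < e.
Proof.
move=> [D [/countable_injP[f finj] Dd]].
have near (x : K) (e : R) : 0 < e -> exists2 y : K, D y & valr (y - x) < e.
  move=> e0; have [] := Dd (ball (x : valued_metric K) e)°.
  - by exists x; exact: nbhsx_ballx.
  - exact: open_interior.
  move=> y [/interior_subset]; rewrite ballEmdist/= => xy Dy.
  by exists y => //; rewrite valrB.
have [d dP] : exists d : nat -> K, forall y, D y -> d (f y) = y.
  have /choice[d dP] : forall n : nat, exists y : K, forall z, D z -> f z = n -> y = z.
    move=> n; have [[z [Dz fz]]|none] := pselect (exists z, D z /\ f z = n).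
      by exists z => t Dt ft; apply: finj; rewrite ?inE// fz ft.
    by exists 0 => z Dz fz; exfalso; apply: none; exists z.
  by exists d => y Dy; exact: dP.
exists d => x e e0; have [y Dy xy] := near x e e0.
by exists (f y); rewrite dP.
Qed.

(** The countable family is indexed by finite lists [s] of indices into a dense
sequence of scalars: entry number [pickle m] of [s] selects coordinate [m], and
the coordinates whose number exceeds the length of [s] vanish. *)
Lemma exists_dense_seq (R : realType) (K : nonArchValuedFieldType R) :
  separable_space (valued_metric K) ->
  exists y : seq nat -> c0 K,
    (forall s, exists N, supported_le (y s) N) /\
    (forall (z : c0 K) e, 0 < e -> exists s, forall m, valr (y s m - z m) < e).
Proof.
move=> /separable_enum[d dP].
pose g (s : seq nat) (m : int) : K^o :=
  if (pickle m < size s)%N then d (nth 0%N s (pickle m)) else 0.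
have g_supp s : exists N, supported_le (g s) N.
  exists (\max_(i < size s) `|odflt (Posz 0) (@pickle_inv int i)|)%N => m.
  rewrite /g; case: ifPn => // ms.
  rewrite ltnNge => /negP[].
  have := leq_bigmax (Ordinal ms)
    (F := fun i : 'I_(size s) => `|odflt (Posz 0) (@pickle_inv int i)|%N).
  by rewrite /= pickleK_inv.
have /choice[y yP] : forall s, exists u : c0 K, forall m, u m = g s m.
  by move=> s; have [N gN] := g_supp s; exists (C0 (c0_pred_supported _ _ gN)).
exists y; split=> [s|z e e0].
  by have [N gN] := g_supp s; exists N => m /gN; rewrite yP.
have [N zN] := (c0_predP z).1 (c0_funP z) e e0.
have /choice[i iP] := fun m => dP (z m) e e0.
pose L := (\max_(j < N.*2.+1) (pickle (j%:Z - N%:Z)%R).+1)%N.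
exists (mkseq (fun j => i (odflt (Posz 0) (@pickle_inv int j))) L) => m.
rewrite yP /g size_mkseq; case: ifPn => mL.
  by rewrite nth_mkseq// pickleK_inv.
rewrite sub0r valrN; apply: zN; rewrite ltnNge; apply: contra mL => mN.
have mi : (absz (m + N%:Z)%R < N.*2.+1)%N by lia.
have := leq_bigmax (Ordinal mi)
  (F := fun j : 'I_(N.*2.+1) => (pickle (j%:Z - N%:Z)%R).+1).
by have /= -> : (absz (m + N%:Z))%:Z - N%:Z = m by lia.
Qed.

(** * Products of consecutive weights *)

Section Weights.
Context {R : realType} {K : nonArchValuedFieldType R}.
Variable a : int -> K.
Implicit Types (k : int) (n : nat).

Definition weight k n : K := \prod_(i < n) a (k + 1 + i%:Z).

Lemma weight0 k : weight k 0 = 1.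
Proof. by rewrite /weight big_ord0. Qed.

Lemma weightS k n : weight k n.+1 = a (k + 1) * weight (k + 1) n.
Proof.
rewrite /weight big_ord_recl addr0; congr (_ * _); apply: eq_bigr => i _.
by congr a; rewrite lift0; lia.
Qed.

Lemma weightD k m n : weight k (m + n) = weight k m * weight (k + m%:Z) n.
Proof.
elim: m k => [|m IH] k; first by rewrite weight0 mul1r addr0.
rewrite addSn !weightS IH -mulrA; congr (_ * (_ * weight _ _)); lia.
Qed.

Lemma valr_weight_le (M : R) k n :
  (forall i, valr (a i) <= M) -> valr (weight k n) <= M ^+ n.
Proof.
move=> aM; elim: n k => [|n IH] k; first by rewrite weight0 valr1 expr0.
by rewrite weightS valrM exprS ler_pM ?valr_ge0.
Qed.

Hypothesis a_neq0 : forall i, a i != 0.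

Lemma weight_neq0 k n : weight k n != 0.
Proof. by apply/prodf_neq0 => i _. Qed.

Lemma valr_weight_gt0 k n : 0 < valr (weight k n).
Proof. by rewrite valr_gt0 weight_neq0. Qed.

Lemma prod_forward_weights (q n : nat) :
  \prod_(1 <= i < (n + q).+1) valr ((a i%:Z)^-1) =
  (valr (weight 0 q))^-1 * (valr (weight q%:Z n))^-1.
Proof.
rewrite -invfM -valrM; have := weightD 0 q n; rewrite add0r => <-.
rewrite -valrV /weight -prodfV valr_prod addnC big_add1 big_mkord/=.
by apply: eq_bigr => i _; congr (valr (a _)^-1); lia.
Qed.

Lemma prod_backward_weights (q n : nat) : (q <= n)%N ->
  \prod_(1 <= j < (n - q).+1) valr (a (- j%:Z + 1)) =
  (valr (weight 0 q))^-1 * valr (weight (q%:Z - n%:Z) n).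
Proof.
move=> qn; have := weightD (q%:Z - n%:Z) (n - q) q.
have -> : q%:Z - n%:Z + (n - q)%N%:Z = 0 by lia.
rewrite subnK// => ->; rewrite valrM mulrCA mulVf ?gt_eqF ?valr_weight_gt0//.
rewrite mulr1 /weight valr_prod big_add1 big_nat_rev big_mkord/=.
apply: eq_bigr => i _; congr (valr (a _)); have := ltn_ord i; lia.
Qed.

(** Moving the window of a weight product by [j] places changes it by two
products of [j] weights, one at the fixed place [q - j] and the other at most
[M ^+ j]. Hence the windows at [q] and [q - n] control, uniformly in [n], those
at all the neighbouring places to their left. *)
Lemma weight_window_bound (q : int) (L : nat) : bounded_weights a ->
  exists2 D : R, 0 < D & forall (j : nat) n, (j < L)%N ->
    (valr (weight (q - j%:Z) n))^-1 <= D / valr (weight q n) /\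
    valr (weight (q - j%:Z - n%:Z) n) <= D * valr (weight (q - n%:Z) n).
Proof.
move=> [M aM].
have M0 : 0 < M by apply: lt_le_trans (aM 0); rewrite valr_gt0.
pose D j := M ^+ j / valr (weight (q - j%:Z) j).
have D0 j : 0 < D j by rewrite divr_gt0 ?exprn_gt0 ?valr_weight_gt0.
exists (1 + \sum_(j < L) D j).
  by rewrite ltr_pwDl// sumr_ge0// => j _; rewrite ltW.
move=> j n jL; have DjD : D j <= 1 + \sum_(j < L) D j.
  rewrite (bigD1 (Ordinal jL))//= addrCA lerDl addr_ge0// sumr_ge0// => i _.
  by rewrite ltW.
split.
  apply: (@le_trans _ _ (D j / valr (weight q n))); last first.
    by rewrite ler_wpM2r// invr_ge0 valr_ge0.
  have E : valr (weight (q - j%:Z) j) * valr (weight q n) =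
      valr (weight (q - j%:Z) n) * valr (weight (q - j%:Z + n%:Z) j).
    by rewrite -!valrM -weightD addnC weightD; congr (valr (_ * weight _ _)); lia.
  rewrite /D -mulrA -invfM E ler_pdivlMr ?mulr_gt0 ?valr_weight_gt0//.
  by rewrite mulKf ?gt_eqF ?valr_weight_gt0// valr_weight_le.
apply: (@le_trans _ _ (D j * valr (weight (q - n%:Z) n))); last first.
  by rewrite ler_wpM2r// valr_ge0.
have E : valr (weight (q - j%:Z - n%:Z) n) * valr (weight (q - j%:Z) j) =
    valr (weight (q - j%:Z - n%:Z) j) * valr (weight (q - n%:Z) n).
  have := weightD (q - j%:Z - n%:Z) n j; rewrite addnC weightD => /(congr1 valr).
  rewrite !valrM => H; rewrite -[X in valr (weight X j)](subrK n%:Z) -H.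
  by congr (_ * valr (weight _ _)); lia.
rewrite /D mulrAC ler_pdivlMr ?valr_weight_gt0// E.
by rewrite ler_wpM2r ?valr_ge0 ?valr_weight_le.
Qed.

End Weights.

(** * Iterates of the backward shift *)

Section BackwardShift.
Context {R : realType} {K : nonArchValuedFieldType R}.
Variables (a : int -> K) (B : {linear c0 K -> c0 K}).
Hypothesis B_shift : is_backward_shift a B.
Implicit Types (x y u v : c0 K).

Lemma shift_supportedE u N m : supported_le u N ->
  B u m = a (m + 1) * u (m + 1).
Proof.
move=> uN; rewrite [in RHS](supported_le_sum _ _ uN) [in LHS](supported_le_sum _ _ uN).
rewrite linear_sum !c0_sumE mulr_sumr; apply: eq_bigr => i _.
set k := i%:Z - N%:Z; rewrite linearZ B_shift.2.
change (u k * (a k * (m == k - 1)%:R) = a (m + 1) * (u k * (m + 1 == k)%:R)).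
have -> : (m == k - 1) = (m + 1 == k) by lia.
have [<-|_] := eqVneq (m + 1) k; last by rewrite !mulr0.
by rewrite mulrCA.
Qed.

(** Both sides agree on the truncations of [x], which converge to [x], and [B] is
continuous. *)
Lemma shiftE x m : B x m = a (m + 1) * x (m + 1).
Proof.
apply/eqP; rewrite -subr_eq0; apply/eqP/(@valr_eq0 R K)/eqP.
rewrite eq_le valr_ge0 andbT; apply/ler_addgt0Pr => e e0; rewrite add0r.
have [d d0 Bd] : exists2 d : R, 0 < d & forall z : c0 K,
    (forall i, valr (z i) < d) -> valr (B z m) <= e.
  have /(@nbhs_ballP R)[d /= d0 Bd] : nbhs (0 : c0 K) (B @^-1` ball (0 : c0 K) e).
    have := B_shift.1 (0 : c0 K) => /cvg_ballP/(_ e e0).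
    by rewrite linear0.
  exists (d / 2) => [|z zd]; first by rewrite divr_gt0.
  have /Bd : ball (0 : c0 K) d z.
    rewrite ballEmdist/=; apply: (@le_lt_trans _ _ (d / 2)).
      by apply: c0_norm_le => i; rewrite c0_subE sub0r valrN ltW.
    by rewrite ltr_pdivrMr// ltr_pMr// ltr1n.
  rewrite /preimage ballEmdist/= => Bz.
  have := valr_le_c0_norm (0 - B z) m; rewrite c0_subE sub0r valrN => Bzm.
  exact: ltW (le_lt_trans Bzm Bz).
have [N xN] := (c0_predP x).1 (c0_funP x) d d0.
pose L := maxn N `|m + 1|; pose u := truncate x L.
have um : u (m + 1) = x (m + 1).
  by rewrite /u /= /truncate_fun leq_max leqnn orbT.
have uL : supported_le u L by exact: truncate_supported.
rewrite -um -(shift_supportedE _ _ _ uL) -c0_subE -linearB; apply: Bd => i.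
rewrite c0_subE /u /= /truncate_fun; case: ifPn => iL.
  by rewrite subrr valr0.
by rewrite subr0; apply: xN; move: iL; rewrite /L; lia.
Qed.

Lemma iter_shiftE n x m : iter n B x m = weight a m n * x (m + n%:Z).
Proof.
elim: n m => [|n IH] m; first by rewrite weight0 mul1r addr0.
by rewrite iterS shiftE IH weightS -mulrA; congr (_ * (_ * x _)); lia.
Qed.

End BackwardShift.

(** * Dense orbits up to a set of scalars *)

Definition cyclic_over {R : realType} {K : nonArchValuedFieldType R}
    (Lam : set K) (T : c0 K -> c0 K) :=
  exists x : c0 K,
    dense [set y | exists (c : K) (n : nat), Lam c /\ y = c *: iter n T x].

Lemma hypercyclicE (R : realType) (K : nonArchValuedFieldType R)
  (T : c0 K -> c0 K) : hypercyclic T <-> cyclic_over [set 1] T.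
Proof.
split=> -[x xd]; exists x => O O0 Oo.
  have [y [Oy [n _ E]]] := xd O O0 Oo; exists y; split => //.
  by exists 1, n; rewrite scale1r E.
have [y [Oy [c [n [c1 E]]]]] := xd O O0 Oo; exists y; split => //.
by exists n => //; rewrite E c1 scale1r.
Qed.

Lemma supercyclicE (R : realType) (K : nonArchValuedFieldType R)
  (T : c0 K -> c0 K) : supercyclic T <-> cyclic_over setT T.
Proof.
split=> -[x xd]; exists x => O O0 Oo.
  by have [y [Oy [c [n E]]]] := xd O O0 Oo; exists y; split=> //; exists c, n.
by have [y [Oy [c [n [_ E]]]]] := xd O O0 Oo; exists y; split=> //; exists c, n.
Qed.

Section SmallTimes.
Context {R : realType} {K : nonArchValuedFieldType R}.

(** The scalar [c] is shared by both inequalities: it may trade one for the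
other. *)
Definition small_times (Lam : set K) (f g : nat -> R) :=
  forall e, 0 < e -> forall N, exists n (c : K),
    [/\ (N <= n)%N, Lam c, c != 0, (valr c)^-1 * f n < e & valr c * g n < e].

Lemma small_times1 (f g : nat -> R) (s : R) : 0 < s ->
  small_times [set 1] f g <->
  forall e, 0 < e -> forall N, exists n, (N <= n)%N /\
    Num.max (s * f n) (s * g n) < e.
Proof.
move=> s0; split=> H e e0 N.
  have [n [c [Nn -> _]]] := H (e / s) (divr_gt0 e0 s0) N.
  rewrite valr1 invr1 !mul1r => fn gn; exists n; split => //.
  by rewrite gt_max -!ltr_pdivlMl// mulrC fn gn.
have [n [Nn]] := H (s * e) (mulr_gt0 s0 e0) N.
rewrite gt_max !ltr_pM2l// => /andP[fn gn]; exists n, 1.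
by rewrite valr1 invr1 !mul1r oner_neq0.
Qed.

(** Only the product of [f] and [g] matters when all scalars are available: a
scalar whose size is about [f n / e] makes the first term less than [e] and
the second one about [f n * g n / e]. *)
Lemma small_timesT (f g : nat -> R) (s : R) : nontrivially_valued K -> 0 < s ->
  (forall n, 0 < f n) -> (forall n, 0 < g n) ->
  small_times setT f g <->
  forall e, 0 < e -> forall N, exists n, (N <= n)%N /\ (s * f n) * (s * g n) < e.
Proof.
move=> Knt s0 f0 g0; split=> H e e0 N.
  pose d := Num.min (e / (s * s)) 1.
  have d0 : 0 < d by rewrite lt_min divr_gt0 ?mulr_gt0 ?ltr01.
  have [n [c [Nn _ c0 fn gn]]] := H d d0 N; exists n; split => //.
  have vc0 : 0 < valr c by rewrite valr_gt0.
  have -> : s * f n * (s * g n) = s * s * ((valr c)^-1 * f n * (valr c * g n)).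
    by field; rewrite gt_eqF.
  rewrite mulrC -ltr_pdivlMr ?mulr_gt0//; apply: (@lt_le_trans _ _ (d * 1)).
    rewrite ltr_pM ?mulr_ge0 ?invr_ge0 ?(ltW vc0) ?(ltW (f0 _)) ?(ltW (g0 _))//.
    by rewrite (lt_le_trans gn)// ge_min lexx orbT.
  by rewrite mulr1 ge_min lexx.
have [p p01] := exists_valr_lt1 Knt; have /andP[p0 _] := p01.
have [n [Nn fgn]] := H (s * s * (e * e * valr p))
  (mulr_gt0 (mulr_gt0 s0 s0) (mulr_gt0 (mulr_gt0 e0 e0) p0)) N.
have [c [c0 ct tc]] := exists_valr_between p (f n / (e * valr p)) p01
  (divr_gt0 (f0 n) (mulr_gt0 e0 p0)).
have vc0 : 0 < valr c by rewrite valr_gt0.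
exists n, c; split => //.
  rewrite mulrC ltr_pdivrMr// -ltr_pdivrMl// mulrC; apply: le_lt_trans tc.
  by rewrite invfM mulrA mulfVK ?gt_eqF.
apply: (@le_lt_trans _ _ (f n / (e * valr p) * g n)).
  by rewrite ler_wpM2r// ltW.
rewrite mulrAC ltr_pdivrMr ?mulr_gt0// mulrA.
by move: fgn; rewrite mulrACA ltr_pM2l ?mulr_gt0.
Qed.

(** The scalar cancels in [f n * g n], which would be less than the square of
the precision; as finitely many [n] leave a positive lower bound for
[f n * g n], asking for enough precision makes [n] large. *)
Lemma small_times_of_pos (f g : nat -> R) (Lam : set K) :
  (forall n, 0 < f n) -> (forall n, 0 < g n) ->
  (forall e, 0 < e -> exists n (c : K),
    [/\ (0 < n)%N, Lam c, c != 0, (valr c)^-1 * f n < e & valr c * g n < e]) ->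
  small_times Lam f g.
Proof.
move=> f0 g0 H e e0 N.
have [d d0 dN] : exists2 d : R, 0 < d & forall n, (n < N)%N -> d <= f n * g n.
  elim: N => [|N [d d0 IH]]; first by exists 1.
  exists (Num.min d (f N * g N)); first by rewrite lt_min d0 mulr_gt0.
  move=> n; rewrite ltnS leq_eqVlt => /predU1P[->|nN]; rewrite ge_min.
    by rewrite lexx orbT.
  by rewrite IH.
pose b := Num.min e (Num.min d 1).
have b0 : 0 < b by rewrite !lt_min e0 d0 ltr01.
have [n [c [n0 Lc c0 fn gn]]] := H b b0.
have be : b <= e by rewrite ge_min lexx.
exists n, c; split => //; [|exact: lt_le_trans be..].
rewrite leqNgt; apply/negP => /dN; rewrite leNgt => /negP[].
have vc0 : 0 < valr c by rewrite valr_gt0.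
have -> : f n * g n = (valr c)^-1 * f n * (valr c * g n).
  by field; rewrite gt_eqF.
apply: (@lt_le_trans _ _ (b * 1)).
  rewrite ltr_pM ?mulr_ge0 ?invr_ge0 ?(ltW vc0) ?(ltW (f0 _)) ?(ltW (g0 _))//.
  by rewrite (lt_le_trans gn)// !ge_min lexx !orbT.
by rewrite mulr1 !ge_min lexx orbT.
Qed.

End SmallTimes.

(** * Necessity: two returns near the same basis vector *)

Section BackwardShiftCyclicity.
Context {R : realType} {K : nonArchValuedFieldType R}.
Hypothesis K_nontrivial : nontrivially_valued K.
Variables (a : int -> K) (B : {linear c0 K -> c0 K}).
Hypothesis a_neq0 : forall i, a i != 0.
Hypothesis B_shift : is_backward_shift a B.
Variable Lam : set K.

(** [B^n] maps [e_{q+n}] to [weight q n] times [e_q]; this is the size of the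
preimage of [e_q] that is a multiple of [e_{q+n}]. *)
Definition inv_weight (q : int) n : R := (valr (weight a q n))^-1.
(** The norm of [B^n e_q], a multiple of [e_{q-n}]. *)
Definition back_weight (q : int) n : R := valr (weight a (q - n%:Z) n).

Hypothesis Lam_div : forall c d, Lam c -> Lam d -> c != 0 -> d != 0 -> Lam (d / c).

Definition peaked_at (q : int) (e : R) (z : c0 K) :=
  valr (z q) = 1 /\ forall k, k != q -> valr (z k) < e.

(** The second vector is [c2 / c1] times the image of the first under [B ^ n].
Its coordinate [q] has absolute value 1 and comes from the small coordinate
[q + n] of the first; its coordinate [q - n] is small and comes from the
coordinate [q] of the first, whose absolute value is 1. *)
Lemma peaked_return q e (x : c0 K) c1 c2 m n : (0 < n)%N ->
  Lam c1 -> Lam c2 ->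
  peaked_at q e (c1 *: iter m B x) -> peaked_at q e (c2 *: iter (n + m) B x) ->
  exists n (c : K), [/\ (0 < n)%N, Lam c, c != 0,
    (valr c)^-1 * inv_weight q n < e & valr c * back_weight q n < e].
Proof.
move=> n0 L1 L2; set z1 := c1 *: _; set z2 := c2 *: _ => -[z1q z1e] [z2q z2e].
have scalar_neq0 (c : K) (z : c0 K) : valr ((c *: z) q) = 1 -> c != 0.
  apply: contra_eqN => /eqP ->; rewrite scale0r.
  by rewrite (valr0 : valr ((0 : c0 K) q) = 0) eq_sym oner_eq0.
have c10 : c1 != 0 by exact: scalar_neq0 z1q.
have c20 : c2 != 0 by exact: scalar_neq0 z2q.
have z21 k : valr (z2 k) = valr (c2 / c1) * valr (weight a k n) * valr (z1 (k + n%:Z)).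
  rewrite -!valrM.
  change (valr (c2 * iter (n + m) B x k) =
    valr (c2 / c1 * weight a k n * (c1 * iter m B x (k + n%:Z)))).
  rewrite iterD (iter_shiftE _ _ B_shift); congr valr; field.
  by [].
have w0 k : 0 < valr (weight a k n) by exact: valr_weight_gt0.
have v0 : 0 < valr (c2 / c1) by rewrite valr_gt0 mulf_neq0// invr_eq0.
exists n, (c2 / c1); split => //; first exact: Lam_div.
- by rewrite mulf_neq0// invr_eq0.
- suff -> : (valr (c2 / c1))^-1 * inv_weight q n = valr (z1 (q + n%:Z)).
    by apply: z1e; lia.
  rewrite /inv_weight -invfM -[LHS]mulr1 -z2q z21 mulKf//.
  by rewrite mulf_neq0 ?gt_eqF.
- suff -> : valr (c2 / c1) * back_weight q n = valr (z2 (q - n%:Z)).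
    by apply: z2e; lia.
  by rewrite z21 subrK z1q mulr1.
Qed.

(** The orbit is made to visit [e_q] and [e_q + b e_{q+1}] within [|b|]. Both
visits are peaked at [q], and their coordinates at [q + 1] are respectively
smaller than [|b|] and of absolute value [|b|]; hence the two vectors are not
proportional and the visits take place at different times. *)
Lemma cyclic_small_times (q : int) : cyclic_over Lam B ->
  small_times Lam (inv_weight q) (back_weight q).
Proof.
move=> [x xd]; apply: small_times_of_pos => [n|n|e e0].
- by rewrite invr_gt0 valr_weight_gt0.
- exact: valr_weight_gt0.
have [b b0] : exists2 b : K, b != 0 & valr b < Num.min e 1.
  by apply: exists_valr_small => //; rewrite lt_min e0 ltr01.
rewrite lt_min => /andP[be b1].
have vb0 : 0 < valr b by rewrite valr_gt0.
have hit := (dense_c0P _).1 xd _ _ vb0.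
have [_ [c1 [m1 [L1 ->]]] z1P] := hit (basis_vec q).
have [_ [c2 [m2 [L2 ->]]] z2P] := hit (basis_vec q + b *: basis_vec (q + 1)).
set z1 := c1 *: _ in z1P; set z2 := c2 *: _ in z2P.
have ev (j k : int) : basis_vec j k = (k == j)%:R :> K by [].
have t2 (k : int) : (basis_vec q + b *: basis_vec (q + 1)) k =
  (k == q)%:R + b * (k == q + 1)%:R :> K by [].
have z1q : valr (z1 q) = 1.
  have := z1P q; rewrite ev eqxx => h; rewrite -(@valr1 R K).
  by apply: valr_isosceles; rewrite valr1 (lt_trans h).
have z2q : valr (z2 q) = 1.
  have := z2P q; rewrite t2 eqxx.
  have -> : (q == q + 1) = false by lia.
  rewrite mulr0 addr0 => h; rewrite -(@valr1 R K).
  by apply: valr_isosceles; rewrite valr1 (lt_trans h).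
have z1k k : k != q -> valr (z1 k) < valr b.
  by move=> /negbTE kq; have := z1P k; rewrite ev kq subr0.
have z2q1 : valr (z2 (q + 1)) = valr b.
  have := z2P (q + 1); rewrite t2 eqxx.
  have -> : (q + 1 == q) = false by lia.
  by rewrite add0r mulr1; exact: valr_isosceles.
have P1 : peaked_at q e z1.
  by split=> // k /z1k zk; exact: lt_trans be.
have P2 : peaked_at q e z2.
  split=> // k /negbTE kq; have [->|/negbTE k1] := eqVneq k (q + 1).
    by rewrite z2q1.
  by have := z2P k; rewrite t2 kq k1 mulr0 addr0 subr0 => zk; exact: lt_trans be.
have [m12|m21|m12] := ltngtP m1 m2.
- apply: (@peaked_return q e x c1 c2 m1 (m2 - m1)) => //; first by rewrite subn_gt0.
  by rewrite subnK// ltnW.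
- apply: (@peaked_return q e x c2 c1 m2 (m1 - m2)) => //; first by rewrite subn_gt0.
  by rewrite subnK// ltnW.
(* At equal times the two vectors are proportional. *)
exfalso; have zE (c : K) (y : c0 K) k : valr ((c *: y) k) = valr c * valr (y k).
  by rewrite -valrM.
have := z1k (q + 1); rewrite -z2q1 /z1 /z2 m12 !zE.
have yq : valr (iter m2 B x q) != 0.
  by apply/eqP => y0; move/eqP: z2q; rewrite zE y0 mulr0 eq_sym oner_eq0.
have -> : valr c1 = valr c2.
  by apply: (mulIf yq); rewrite -!zE -[in LHS]m12 z1q z2q.
by rewrite ltxx => H; have : false by apply: H; lia.
Qed.

End BackwardShiftCyclicity.

(** * Sufficiency: summing small blocks *)

Section ForwardBlock.
Context {R : realType} {K : nonArchValuedFieldType R}.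
Variables (a : int -> K) (B : {linear c0 K -> c0 K}).
Hypotheses (a_neq0 : forall i, a i != 0) (a_bounded : bounded_weights a).
Hypothesis B_shift : is_backward_shift a B.
Variable Lam : set K.
Hypothesis small : forall q : nat, (0 < q)%N ->
  small_times Lam (inv_weight a q) (back_weight a q).

(** The block is [v = c^-1 S^n y], where [S] is the weighted forward shift
inverting [B] on vectors of finite support. Only the places [k] with
[|k| <= q] matter, for which [weight_window_bound] reduces the growth of
[S^n e_k] and [B^n e_k] to that of [S^n e_q] and [B^n e_q]. *)
Lemma forward_block (u y : c0 K) (q : nat) (e : R) :
  (0 < q)%N -> supported_le u q -> supported_le y q -> 0 < e -> forall N : nat,
  exists n (c : K) (v : c0 K), [/\ Lam c /\ c != 0,
    supported_le v (n + q),
    forall m : int, m <= N%:Z -> v m = 0,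
    forall m, valr (v m) < e &
    forall m, valr (c * iter n B u m) < e /\ c * iter n B v m = y m].
Proof.
move=> q0 uq yq e0 N.
have [D D0 DP] := weight_window_bound a a_neq0 q q.*2.+1 a_bounded.
pose C := 1 + (c0_norm u + c0_norm y).
have nn (z : c0 K) : 0 <= c0_norm z.
  exact: le_trans (valr_ge0 _) (valr_le_c0_norm z 0).
have Cpos : 0 < C by rewrite ltr_pwDl// addr_ge0.
have uC m : valr (u m) <= C.
  by have := valr_le_c0_norm u m; have := nn y; rewrite /C; lra.
have yC m : valr (y m) <= C.
  by have := valr_le_c0_norm y m; have := nn u; rewrite /C; lra.
have [n [c [Nn Lc c0 cf cg]]] := small q q0 (e / (C * D))
  (divr_gt0 e0 (mulr_gt0 Cpos D0)) (N + q).+1.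
have vc0 : 0 < valr c by rewrite valr_gt0.
have window (k : int) : (`|k| <= q)%N ->
    (valr (weight a k n))^-1 <= D * inv_weight a q n /\
    valr (weight a (k - n%:Z) n) <= D * back_weight a q n.
  move=> kq; have jq : (`|(q%:Z - k)%R| < q.*2.+1)%N by lia.
  have := DP _ n jq.
  by have -> : q%:Z - (absz (q%:Z - k))%:Z = k by lia.
have bound (x w t : R) : 0 <= x <= C -> 0 <= w -> w <= D * t ->
    forall s, 0 < s -> s * t < e / (C * D) -> s * w * x < e.
  move=> /andP[x0 xC] w0 wD s s0 st.
  apply: (@le_lt_trans _ _ (s * (D * t) * C)).
    by apply: ler_pM => //; [rewrite mulr_ge0// ltW|rewrite ler_wpM2l// ltW].
  have -> : s * (D * t) * C = s * t * (C * D) by ring.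
  by rewrite -ltr_pdivlMr// mulr_gt0.
pose g (m : int) : K^o := c^-1 * (weight a (m - n%:Z) n)^-1 * y (m - n%:Z).
have g_supp : supported_le g (n + q).
  by move=> m nm; rewrite /g yq ?mulr0//; lia.
have w0 k : weight a k n != 0 by exact: weight_neq0.
exists n, c, (C0 (c0_pred_supported _ _ g_supp)); split=> //= m.
- by move=> mN; rewrite /g yq ?mulr0//; lia.
- have [mq|mq] := leqP (absz (m - n%:Z)) q; last first.
    by rewrite /g yq// mulr0 valr0.
  rewrite /g !valrM !valrV; apply: (bound _ _ _ _ _ (window _ mq).1) => //.
  + by rewrite valr_ge0 yC.
  + by rewrite invr_ge0 valr_ge0.
  + by rewrite invr_gt0.
split; rewrite (iter_shiftE _ _ B_shift).
  have [mq|mq] := leqP (absz (m + n%:Z)) q; last first.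
    by rewrite uq// !mulr0 valr0.
  rewrite mulrA !valrM.
  have := (window _ mq).2; rewrite addrK => W.
  by apply: (bound _ _ _ _ _ W) => //; rewrite valr_ge0// uC.
rewrite /= /g addrK; field.
by rewrite c0 w0.
Qed.

End ForwardBlock.

Section Gluing.
Context {R : realType} {K : nonArchValuedFieldType R}.

(** A limit of vectors whose coordinates stabilise: coordinate [m] is final at
stage [|m|], and the ultrametric inequality keeps all later stages within
[r k] of stage [k]. *)
Lemma glue_blocks (u : nat -> c0 K) (N : nat -> nat) (r : nat -> R) :
  (forall k, (N k < N k.+1)%N) -> (forall k, r k.+1 <= r k) ->
  (forall e, 0 < e -> exists k, r k < e) ->
  (forall k (m : int), m <= (N k)%:Z -> u k.+1 m = u k m) ->
  (forall k m, valr (u k.+1 m - u k m) <= r k) ->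
  exists x : c0 K, forall k m, valr (x m - u k m) <= r k.
Proof.
move=> N_incr r_decr r_small u_stable u_close.
have N_homo : {homo N : i j / (i <= j)%N} by apply: homo_leq => // [i j k|i];
  [exact: leq_trans|exact: ltnW].
have N_ge k : (k <= N k)%N.
  by elim: k => // k IH; exact: leq_ltn_trans IH (N_incr k).
have r_homo i j : r (i + j)%N <= r i.
  by elim: j => [|j IH]; [rewrite addn0|rewrite addnS (le_trans (r_decr _))].
have r_ge0 k : 0 <= r k by apply: le_trans (u_close k 0); exact: valr_ge0.
have stable i j (m : int) : m <= (N i)%:Z -> u (i + j)%N m = u i m.
  move=> mi; elim: j => [|j <-]; first by rewrite addn0.
  rewrite addnS u_stable//; apply: le_trans mi _.
  by rewrite lez_nat N_homo ?leq_addr.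
have close i j (m : int) : valr (u (i + j)%N m - u i m) <= r i.
  elim: j => [|j IH]; first by rewrite addn0 subrr valr0.
  rewrite -(subrK (u (i + j)%N m) (u (i + j.+1)%N m)) -addrA valrD_le//.
  by rewrite addnS (le_trans (u_close _ _)).
pose g (m : int) : K^o := u `|m|%N m.
have g_close k m : valr (g m - u k m) <= r k.
  rewrite /g; have [mk|km] := leqP `|m| k; last first.
    by rewrite -(subnKC (ltnW km)).
  rewrite -(subnKC mk) stable ?subrr ?valr0//.
  by have := N_ge `|m|%N; lia.
have g_c0 : g \in c0_pred.
  apply: c0_pred_uniform_limit => e e0; have [k rk] := r_small e e0.
  by exists (u k) => m; exact: le_lt_trans rk.
by exists (C0 g_c0).
Qed.

End Gluing.

Section Universality.
Context {R : realType} {K : nonArchValuedFieldType R}.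
Variables (a : int -> K) (B : {linear c0 K -> c0 K}).
Hypotheses (a_neq0 : forall i, a i != 0) (a_bounded : bounded_weights a).
Hypothesis B_shift : is_backward_shift a B.
Variable Lam : set K.
Hypothesis small : forall q : nat, (0 < q)%N ->
  small_times Lam (inv_weight a q) (back_weight a q).

(** One stage of the construction: [N] bounds the support of the current vector
[u] and [r] is the size allowed for further changes. The new tolerance [r']
protects the approximation of [y] that has just been obtained, so that every
later vector within [r'] still has it. *)
Lemma approximation_step (u y : c0 K) (N : nat) (r e : R) :
  supported_le u N -> (exists M, supported_le y M) -> 0 < r -> 0 < e ->
  exists (u' : c0 K) (N' : nat) (r' : R),
  [/\ supported_le u' N' /\ (N < N')%N, 0 < r' <= r / 2,
    forall m : int, m <= N%:Z -> u' m = u m,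
    forall m, valr (u' m - u m) <= r &
    exists c n, Lam c /\ forall x : c0 K, (forall m, valr (x m - u' m) <= r') ->
      forall m, valr (c * iter n B x m - y m) < e].
Proof.
move=> uN [L yL] r0 e0; have [M aM] := a_bounded.
have M0 : 0 < M by apply: lt_le_trans (aM 0); rewrite valr_gt0.
have supp_max (z : c0 K) i j : supported_le z i -> (i <= j)%N -> supported_le z j.
  by move=> zi ij m jm; apply: zi; exact: leq_ltn_trans jm.
have re0 : 0 < Num.min r e by rewrite lt_min r0.
have [q [q0 Nq Lq]] : exists q : nat, [/\ 0 < q, N <= q & L <= q]%N.
  by exists (N + L).+1%N; split; lia.
have uq : supported_le u q by exact: supp_max uN Nq.
have yq : supported_le y q by exact: supp_max yL Lq.
have [n [c [v [[Lc c0] v_supp v_low v_small cB]]]] :=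
  forward_block _ _ a_neq0 a_bounded B_shift _ small u y q (Num.min r e)
    q0 uq yq re0 N.
(* [s] bounds the Lipschitz constant of [c B^n], so later changes of size [e / s]
   are harmless; the summand 1 only serves to make it positive. *)
pose s := valr c * M ^+ n + 1.
have s0 : 0 < s by rewrite ltr_wpDl// mulr_ge0 ?valr_ge0 ?exprn_ge0// ltW.
have uv m : (u + v) m = u m + v m by [].
exists (u + v), (n + q + N).+1, (Num.min (r / 2) (e / s)); split.
- split; last by lia.
  by move=> m Nm; rewrite uv uN ?v_supp ?addr0//; lia.
- by rewrite lt_min !divr_gt0// ge_min lexx.
- by move=> m mN; rewrite uv v_low// addr0.
- move=> m; rewrite uv addrC addKr.
  by apply: ltW (lt_le_trans (v_small m) _); rewrite ge_min lexx.
exists c, n; split => // x xu m.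
have -> : c * iter n B x m - y m =
    c * weight a m n * (x (m + n%:Z) - (u + v) (m + n%:Z)) + c * iter n B u m.
  rewrite -(cB m).2 !(iter_shiftE _ _ B_shift) uv; ring.
apply: valrD_lt; last first.
  by apply: lt_le_trans (cB m).1 _; rewrite ge_min lexx orbT.
rewrite !valrM; apply: (@le_lt_trans _ _ (valr c * M ^+ n * (e / s))).
  apply: ler_pM; rewrite ?mulr_ge0 ?valr_ge0//.
    by rewrite ler_wpM2l ?valr_ge0// valr_weight_le.
  by apply: le_trans (xu _) _; rewrite ge_min lexx orbT.
by rewrite mulrA ltr_pdivrMr// mulrC ltr_pM2l// /s ltrDl ltr01.
Qed.

(** Tolerances are at least halved at each stage, so the stages converge
([glue_blocks]), and the limit is within the tolerance set at stage [k] from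
the vector then obtained, which preserves approximation number [k]. *)
Lemma universal_vector (y : nat -> c0 K) (e : nat -> R) :
  (forall k, exists M, supported_le (y k) M) -> (forall k, 0 < e k) ->
  exists x : c0 K, forall k, exists c n, Lam c /\
    forall m, valr (c * iter n B x m - y k m) < e k.
Proof.
move=> y_supp e0.
pose state := {s : c0 K * nat * R | supported_le s.1.1 s.1.2 /\ 0 < s.2}.
pose cu (s : state) := (sval s).1.1.
pose cN (s : state) := (sval s).1.2.
pose cr (s : state) := (sval s).2.
have step k (s : state) : exists s' : state, [/\ (cN s < cN s')%N,
    cr s' <= cr s / 2,
    forall m : int, m <= (cN s)%:Z -> cu s' m = cu s m,
    forall m, valr (cu s' m - cu s m) <= cr s &
    exists c n, Lam c /\ forall x : c0 K, (forall m, valr (x m - cu s' m) <= cr s') ->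
      forall m, valr (c * iter n B x m - y k m) < e k].
  have [us rs] := svalP s.
  have [u' [N' [r' [[us' NN'] /andP[r'0 r'r] ul uc [c [n cn]]]]]] :=
    approximation_step _ _ _ _ _ us (y_supp k) rs (e0 k).
  exists (exist _ ((u', N'), r') (conj us' r'0)); split => //.
  by exists c, n.
have /choice[next nextP] : forall ks : nat * state, exists s', _ :=
  fun ks => step ks.1 ks.2.
have init : supported_le (0 : c0 K) 0 /\ 0 < (1 : R) by split; [move=> m|].
pose s0 : state := exist _ ((0 : c0 K, 0%N), 1 : R) init.
pose S := fix S k := if k is k'.+1 then next (k', S k') else s0.
have SP k := nextP (k, S k).
have r_pos k : 0 < cr (S k) by case: (svalP (S k)).
have r_half k : cr (S k) <= 2^-1 ^+ k.
  elim: k => [|k IH]; first by rewrite expr0 /cr.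
  have [_ h _ _ _] := SP k; apply: le_trans h _.
  by rewrite exprSr ler_pM2r// invr_gt0.
have [x xP] : exists x : c0 K, forall k m, valr (x m - cu (S k) m) <= cr (S k).
  apply: (glue_blocks (fun k => cu (S k)) (fun k => cN (S k)) (fun k => cr (S k))).
  - by move=> k; have [] := SP k.
  - move=> k; have [_ h _ _ _] := SP k; apply: le_trans h _.
    by have := r_pos k; lra.
  - move=> d d0; have [k kd] := expr_lt_small _ (2^-1 : R) d ltac:(lra) d0.
    by exists k; exact: le_lt_trans kd.
  - by move=> k; have [] := SP k.
  - by move=> k; have [] := SP k.
exists x => k; have [_ _ _ _ [c [n [Lc H]]]] := SP k.
by exists c, n; split => //; apply: H; exact: xP k.+1.
Qed.

(** The targets are enumerated together with all precisions [1 / (i + 1)], so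
that each vector of the dense family is approximated arbitrarily well. *)
Lemma small_times_cyclic : separable_space (valued_metric K) -> cyclic_over Lam B.
Proof.
move=> /exists_dense_seq[y [y_supp y_dense]].
pose t k : seq nat * nat := odflt ([::], 0%N) (unpickle k).
have [x xP] := universal_vector (fun k => y (t k).1) (fun k => (t k).2.+1%:R^-1)
  (fun k => y_supp _) (fun k => ltac:(by rewrite invr_gt0 ltr0Sn)).
exists x; apply/dense_c0P => z e e0.
have [s sz] := y_dense z e e0.
have [i ie] : exists i : nat, i.+1%:R^-1 < e.
  have [i] := ltr_add_invr (e0); rewrite add0r; by exists i.
have [c [n [Lc cn]]] := xP (pickle (s, i)).
exists (c *: iter n B x); first by exists c, n.
move=> m; move: (cn m); rewrite /t pickleK/= => cm.
have -> : (c *: iter n B x) m - z m = (c * iter n B x m - y s m) + (y s m - z m).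
  by rewrite [RHS]addrA subrK.
by apply: valrD_lt; [exact: lt_trans ie|].
Qed.

End Universality.

(** * Characterisation of hypercyclic and supercyclic shifts *)

Theorem theorem4p1 (R : realType) (K : nonArchValuedFieldType R)
    (K_nontrivial : nontrivially_valued K)
    (K_complete : complete_space (valued_metric K))
    (K_separable : separable_space (valued_metric K))
    (a : int -> K)
    (a_neq0 : forall n, a n != 0)
    (a_bounded : bounded_weights a)
    (a_weighted : exists i, a i != 1)
    (B : {linear c0 K -> c0 K})
    (B_shift : is_backward_shift a B) :
  (hypercyclic B <->
     forall q : nat, (0 < q)%N ->
       limn_einf (fun n : nat =>
         (Num.max (\prod_(1 <= i < (n + q).+1) valr ((a i%:Z)^-1))
                  (\prod_(1 <= j < (n - q).+1) valr (a (- j%:Z + 1))))%:E)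
       = (0 : R)%:E)
  /\
  (supercyclic B <->
     forall q : nat, (0 < q)%N ->
       limn_einf (fun n : nat =>
         ((\prod_(1 <= i < (n + q).+1) valr ((a i%:Z)^-1)) *
          (\prod_(1 <= j < (n - q).+1) valr (a (- j%:Z + 1))))%:E)
       = (0 : R)%:E).
Proof.
have prod0 (r : seq nat) (f : nat -> K) : 0 <= \prod_(i <- r) valr (f i).
  by apply: prodr_ge0 => i _; exact: valr_ge0.
have cyclicP (Lam : set K) :
    (forall c d, Lam c -> Lam d -> c != 0 -> d != 0 -> Lam (d / c)) ->
    cyclic_over Lam B <-> forall q : nat, (0 < q)%N ->
      small_times Lam (inv_weight a q) (back_weight a q).
  move=> Ldiv; split=> [cB q _|sm].
    exact: (cyclic_small_times K_nontrivial _ _ a_neq0 B_shift _ Ldiv).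
  exact: (small_times_cyclic _ _ a_neq0 a_bounded B_shift _ sm).
have w_gt0 q : 0 < (valr (weight a 0 q))^-1 by rewrite invr_gt0 valr_weight_gt0.
pose fwd (q n : nat) : R := \prod_(1 <= i < (n + q).+1) valr ((a i%:Z)^-1).
pose bwd (q n : nat) : R := \prod_(1 <= j < (n - q).+1) valr (a (- j%:Z + 1)).
pose s q := (valr (weight a 0 q))^-1.
have fwdE q n : fwd q n = s q * inv_weight a q n by exact: prod_forward_weights.
have bwdE q n : (q <= n)%N -> bwd q n = s q * back_weight a q n.
  exact: prod_backward_weights.
(* For [n < q] the truncated difference [n - q] breaks [bwdE], but the limit
   inferior only sees large [n]. *)
have einfP q (F : R -> R -> R) : (forall x y, 0 <= x -> 0 <= y -> 0 <= F x y) ->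
    limn_einf (fun n => (F (fwd q n) (bwd q n))%:E) = (0 : R)%:E <->
    forall e, 0 < e -> forall N, exists n, (N <= n)%N /\
      F (s q * inv_weight a q n) (s q * back_weight a q n) < e.
  move=> F0; rewrite limn_einf_eq0P; last by move=> n; rewrite F0 ?prod0.
  split=> H e e0 N; have [n [Nn Fn]] := H e e0 (maxn N q);
    have [N_n q_n] : (N <= n)%N /\ (q <= n)%N by lia.
    by exists n; rewrite -fwdE -bwdE.
  by exists n; rewrite fwdE bwdE.
have i0 q n : 0 < inv_weight a q n by rewrite invr_gt0 valr_weight_gt0.
have b0 q n : 0 < back_weight a q n by exact: valr_weight_gt0.
split.
- rewrite hypercyclicE cyclicP; last by move=> c d -> ->; rewrite /= divr1.
  have max0 (x y : R) : 0 <= x -> 0 <= y -> 0 <= Num.max x y.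
    by move=> x0 _; rewrite le_max x0.
  split=> H q q0; first exact/(einfP q _ max0)/(small_times1 _ _ _ (w_gt0 q))/H.
  exact/(small_times1 _ _ _ (w_gt0 q))/(einfP q _ max0)/H.
- rewrite supercyclicE cyclicP//.
  have mul0 (x y : R) : 0 <= x -> 0 <= y -> 0 <= x * y by exact: mulr_ge0.
  split=> H q q0.
    by apply/(einfP q _ mul0)/(small_timesT _ _ _ K_nontrivial (w_gt0 q)) => //; exact: H.
  by apply/(small_timesT _ _ _ K_nontrivial (w_gt0 q))/(einfP q _ mul0)/H.
Qed.
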